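(* Let $X$ be a real Banach space, let $f: X \to\mathbb{R}$ be a (proper) lower semicontinuous convex function and let $\ell\geq 0$. Then $f$ is $\ell$-Lipschitz continuous on $X$ if and only if $$\limsup_{\|x\|\rightarrow+\infty} d(0, \partial f(x)) \leq\ell,$$ where $d(0, \partial f(x)):= \inf\{\Vert x^*\Vert:\, x^* \in \partial f(x)\}$.
   Context: $X^*$ is the continuous dual of $X$ with its dual norm. $f$ is convex (resp. lower semicontinuous) if its epigraph $\{(x,r)\in X\times\mathbb{R}: f(x)\le r\}$ is convex (resp. closed in $X\times\mathbb{R}$); here $f$ is real-valued on all of $X$. $f$ is $\ell$-Lipschitz continuous on $X$ if $|f(x)-f(y)|\le \ell\|x-y\|$ for all $x,y\in X$. The subdifferential of $f$ at $x$ is $\partial f(x)=\{x^*\in X^*: f(y)-f(x)\ge\langle x^*,y-x\rangle\ \forall y\in X\}$. *)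

(* Defs.v *)
From HB Require Import structures.
From mathcomp Require Import all_boot all_order all_algebra.
From mathcomp Require Import all_classical all_reals all_analysis.

Set Implicit Arguments.
Unset Strict Implicit.
Unset Printing Implicit Defensive.

Import Order.TTheory GRing.Theory Num.Theory.
Import numFieldNormedType.Exports.

Local Open Scope classical_set_scope.
Local Open Scope ring_scope.

Section Defs.
Context {R : realType} {X : normedModType R}.

Definition epigraph (f : X -> R^o) : set (X * R^o) :=
  [set p | f p.1 <= p.2].

(* The name avoids [lower_semicontinuous], which the library defines
   for functions into [\bar R] by means of neighborhoods. *)
Definition lsc (f : X -> R^o) : Prop := closed (epigraph f).

Definition convex_fun (f : X -> R^o) : Prop := convex_set (epigraph f).

(* The underlying set of X^*; [{linear X -> R^o}] is the algebraic dual. *)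
Definition dual : set {linear X -> R^o} := [set phi | continuous phi].

(* [sup] takes values in R and is a junk value on unbounded sets, so this is
   the dual norm only when phi belongs to [dual]. *)
Definition dual_norm (phi : {linear X -> R^o}) : R :=
  sup [set `|phi x| | x in [set x : X | `|x| <= 1]].

Definition subdifferential (f : X -> R^o) (x : X) : set {linear X -> R^o} :=
  [set phi | dual phi /\ forall y, phi (y - x) <= f y - f x].

(* d(0, A) for a subset A of X^*; it is +oo when A is empty. *)
Definition dist0 (A : set {linear X -> R^o}) : \bar R :=
  ereal_inf [set (dual_norm phi)%:E | phi in A].

(* The filter of the convergence ||x|| -> +oo. It is improper if X is the zero
   space, and [limf_esup] along it is then the supremum of set0, i.e. -oo. *)
Definition norm_pinfty_nbhs : set_system X :=
  filter_from [set: R] (fun M => [set x : X | M < `|x|]).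

End Defs.

Arguments dual {R} X.
Arguments norm_pinfty_nbhs {R} X.

(* Main.v *)
Require Import Defs.
From HB Require Import structures.
From mathcomp Require Import all_boot all_order all_algebra.
From mathcomp Require Import all_classical all_reals all_analysis.
From mathcomp Require Import ring lra.

Import Order.TTheory GRing.Theory Num.Theory.
Import numFieldNormedType.Exports.

Local Open Scope classical_set_scope.
Local Open Scope ring_scope.

(** Both directions concern the slopes of [f] along lines.

    If [f] is [l]-Lipschitz, then at every point [x] the convex function
    [h |-> f (x + h) - f x] vanishes at 0, hence dominates a linear functional
    by the Hahn-Banach theorem ([hahn_banach_convex]).  Such a functional is a
    subgradient at [x], and being dominated by [l * `|h|] it is continuous of
    norm at most [l] ([lipschitz_subgradient]).  Therefore [dist0] of the
    subdifferential is at most [l] at every point, not only near infinity.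

    Conversely, the slopes of a convex function along a half-line grow, so
    the increment [f y - f x] is controlled by the slope between [x] and a point
    [z] arbitrarily far on the half-line from [x] through [y]
    ([convex_slope_le]).  That slope is at most the value of any subgradient at
    [z] in the direction of the half-line.  Subgradients of norm at most [k] at
    all points far from the origin thus make [f] globally [k]-Lipschitz
    ([subgradient_far_lipschitz]).  The bound on the upper limit gives this for
    every [k > l], and [k] tends to [l]. *)

(** * Convexity *)

(** The library states convexity with a weight bundled with its bounds; the
    two-weight form is the one that suits computations. *)
Lemma convex_functionP (R : realType) (V : lmodType R) (p : V -> R^o) :
  convex_function [set: convex_lmodType V] p <->
  forall (a b : R) x y, 0 <= a -> 0 <= b -> a + b = 1 ->
    p (a *: x + b *: y) <= a * p x + b * p y.
Proof.
split=> [cvx a b x y a0 b0 ab1|cvx t x y _ _].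
  have a1 : a <= 1 by rewrite -ab1 lerDl.
  have -> : b = 1 - a by rewrite -ab1 addrC addKr.
  by apply: (cvx (Itv01 a0 a1)); rewrite inE.
by apply: cvx; [exact: ge0|rewrite subr_ge0; exact: le1|rewrite addrC subrK].
Qed.

(** The convex combination of the points [(x, f x)] and [(y, f y)] of the
    epigraph lies in the epigraph. *)
Lemma convex_fun_convex_function (R : realType) (X : normedModType R)
    (f : X -> R^o) :
  convex_fun f -> convex_function [set: convex_lmodType X] f.
Proof.
move=> cvx t x y _ _.
have /(_ t) := cvx (x, f x) (y, f y); rewrite !inE.
by apply; rewrite /epigraph/=.
Qed.

(** Slopes from [x] grow along a half-line: [x + h] is the convex
    combination of [x + t *: h] and [x] with weights [t^-1] and [1 - t^-1]. *)
Lemma convex_slope_le (R : realType) (V : lmodType R) (f : V -> R^o)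
    (x h : V) (t : R) :
  convex_function [set: convex_lmodType V] f -> 1 <= t ->
  t * (f (x + h) - f x) <= f (x + t *: h) - f x.
Proof.
move=> /convex_functionP cvx t1.
have t0 : 0 < t by lra.
have ti : 0 <= t^-1 by rewrite invr_ge0 ltW.
have ti1 : 0 <= 1 - t^-1 by rewrite subr_ge0 invf_le1.
have := cvx t^-1 (1 - t^-1) (x + t *: h) x ti ti1.
have -> : t^-1 *: (x + t *: h) + (1 - t^-1) *: x = x + h.
  rewrite scalerDr scalerA mulVf ?gt_eqF // scale1r addrAC -scalerDl.
  by rewrite subrKC scale1r.
rewrite subrKC => /(_ erefl) le1.
rewrite -subr_ge0 in le1; rewrite -subr_ge0.
set P := f _ in le1 *; set Q := f (x + h) in le1 *.
have -> : P - f x - t * (Q - f x) = t * (t^-1 * P + (1 - t^-1) * f x - Q).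
  by field; rewrite gt_eqF.
by rewrite mulr_ge0 // ltW.
Qed.

(** * The Hahn-Banach theorem for convex functions *)

Section dominated_extension.
Context (R : realType) (V : lmodType R) (p : V -> R^o).
Hypothesis cvx : convex_function [set: convex_lmodType V] p.
Hypothesis p0 : 0 <= p 0.

(** Graph of a linear functional that is defined on a subspace and is below [p]
    there.  Working with graphs keeps partial functionals free of dependent
    types and orders them by inclusion; single-valuedness follows from the
    domination, see [dominated_graph_fun].  The empty graph is included, being
    the union of the empty chain. *)
Definition dominated_graph (G : set (V * R^o)) :=
  (forall (a : R) v r w s, G (v, r) -> G (w, s) -> G (a *: v + w, a * r + s)) /\
  (forall v r, G (v, r) -> r <= p v).

Lemma dominated_graph_bigcup (F : set (set (V * R^o))) :
  F `<=` dominated_graph -> total_on F subset ->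
  dominated_graph (\bigcup_(G in F) G).
Proof.
move=> FG Ftot; split=> [a v r w s [A FA Ag] [B FB Bh]|v r [A FA Ag]].
  case: (Ftot _ _ FA FB) => [AB|BA].
  - by exists B => //; apply: (FG _ FB).1 => //; exact: AB.
  - by exists A => //; apply: (FG _ FA).1 => //; exact: BA.
exact: (FG _ FA).2.
Qed.

(** If [(0, r)] is in [G] then so is [(0, t * r)] for every [t], and [t * r]
    cannot stay below [p 0] unless [r] vanishes. *)
Lemma dominated_graph0 (G : set (V * R^o)) r :
  dominated_graph G -> G (0, r) -> r = 0.
Proof.
move=> [Glin Gp] G0r.
have G00 : G (0, 0).
  by have := Glin (-1) _ _ _ _ G0r G0r; rewrite scaler0 addr0 mulN1r addNr.
have tr_le t : t * r <= p 0.
  by have /Gp := Glin t _ _ _ _ G0r G00; rewrite scaler0 !addr0.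
apply/eqP; case: (eqVneq r 0) => // r0.
have := tr_le ((p 0 + 1) / r); rewrite divfK //; lra.
Qed.

Lemma dominated_graph_fun (G : set (V * R^o)) v r s :
  dominated_graph G -> G (v, r) -> G (v, s) -> r = s.
Proof.
move=> Gd Gr Gs; apply/eqP; rewrite -subr_eq0; apply/eqP.
apply: (dominated_graph0 _ _ Gd).
by have := Gd.1 (-1) _ _ _ _ Gs Gr; rewrite scaleN1r addNr mulN1r addrC.
Qed.

(** A dominated functional can be extended to one more vector [v], with value
    [r] there.  For [t > 0] domination bounds [r] from above, for [t < 0] from
    below.  Every lower bound is at most every upper bound, since a suitable
    convex combination of [w + t *: v] and [w' - u *: v] cancels [v] and falls
    in the domain, where domination is known.  The supremum of the lower bounds
    is then a valid value. *)
Lemma dominated_slope (G : set (V * R^o)) v :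
  dominated_graph G -> G (0, 0) ->
  exists r : R, forall w s t, G (w, s) -> s + t * r <= p (w + t *: v).
Proof.
move=> [Glin Gp] G00.
have sandwich w s w' s' t u : G (w, s) -> G (w', s') -> 0 < t -> 0 < u ->
    (s' - p (w' - u *: v)) / u <= (p (w + t *: v) - s) / t.
  move=> Gw Gw' t0 u0.
  have tu0 : 0 < t + u by exact: addr_gt0.
  (* the weights for which [v] cancels: [a * t = b * u] *)
  set a := u / (t + u); set b := t / (t + u).
  have ab1 : a + b = 1 by rewrite -mulrDl [u + t]addrC divff ?gt_eqF.
  have Gb : G (b *: w', b * s').
    by have := Glin b _ _ _ _ Gw' G00; rewrite !addr0.
  have /Gp le1 := Glin a _ _ _ _ Gw Gb.
  have := (convex_functionP _ _ p).1 cvx a b (w + t *: v) (w' - u *: v).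
  have -> : a *: (w + t *: v) + b *: (w' - u *: v) = a *: w + b *: w'.
    rewrite !scalerDr scalerN !scalerA addrACA.
    have -> : a * t = b * u by rewrite /a /b; ring.
    by rewrite addrN addr0.
  move=> /(_ (ltW (divr_gt0 u0 tu0)) (ltW (divr_gt0 t0 tu0)) ab1) le2.
  have := le_trans le1 le2.
  rewrite -subr_ge0 /GRing.scale/= => le3.
  rewrite -subr_ge0.
  set P := p _ in le3 *; set Q := p _ in le3 *.
  have -> : (P - s) / t - (s' - Q) / u =
      (a * P + b * Q - (a * s + b * s')) * ((t + u) / (t * u)).
    by rewrite /a /b; field; rewrite !gt_eqF.
  by rewrite mulr_ge0 // divr_ge0 ?mulr_ge0 ?ltW.
pose L := [set (q.1.2 - p (q.1.1 - q.2 *: v)) / q.2 |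
  q in [set q : (V * R^o) * R | G q.1 /\ 0 < q.2]].
have L0 : L !=set0 by eexists; exists ((0, 0), 1).
have Lub w s t : G (w, s) -> 0 < t -> ubound L ((p (w + t *: v) - s) / t).
  by move=> Gw t0 _ [[[w' s'] u]/= [Gw' u0] <-]; exact: sandwich.
exists (sup L) => w s t Gw.
case: (ltgtP t 0) => [t0|t0|->].
- have : (s - p (w - (- t) *: v)) / (- t) <= sup L.
    apply: ub_le_sup; first by eexists; apply: (Lub _ _ 1 G00).
    by exists ((w, s), - t) => //=; rewrite oppr_gt0.
  by rewrite scaleNr opprK ler_pdivrMr ?oppr_gt0 //; lra.
- have : sup L <= (p (w + t *: v) - s) / t by apply: ge_sup => //; exact: Lub.
  by rewrite ler_pdivlMr //; lra.
- by rewrite mul0r scale0r !addr0; exact: Gp.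
Qed.

(** A maximal dominated graph is total: by [dominated_slope] it would otherwise
    have a proper extension.  Convexity of [p] replaces the usual sublinearity,
    so that no directional derivative has to be taken beforehand. *)
Lemma hahn_banach_convex :
  exists phi : {linear V -> R^o}, forall v, phi v <= p v.
Proof.
have [G [Gd Gmax]] := Zorn_bigcup dominated_graph_bigcup.
have [Glin Gp] := Gd.
(* a maximal graph is not empty, as [(0, 0)] alone is a dominated graph *)
have G00 : G (0, 0).
  apply: contrapT => nG; apply: (Gmax (G `|` [set (0, 0)])).
    by split=> [|/(_ (0, 0))]; [exact: subsetUl|move=> /(_ (or_intror erefl))].
  have Gempty v r : ~ G (v, r).
    move=> Gg; apply: nG; have := Glin (-1) _ _ _ _ Gg Gg.
    by rewrite scaleN1r mulN1r !addNr.
  split=> [a v r w s [/Gempty//|[-> ->]] [/Gempty//|[-> ->]]|v r].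
    by right; rewrite /= scaler0 mulr0 !addr0.
  by move=> [/Gempty//|[-> ->]].
have Gtot v : exists r, G (v, r).
  apply: contrapT => nG.
  have [r rP] := dominated_slope _ v Gd G00.
  pose H : set (V * R^o) :=
    [set (g.1 + t *: v, g.2 + t * r) | g in G & t in [set: R]].
  apply: (Gmax H).
    split=> [[w s] Gw|HG].
      by exists (w, s) => //; exists 0 => //=; rewrite scale0r mul0r !addr0.
    apply: nG; exists r; apply: HG.
    by exists (0, 0) => //; exists 1 => //=; rewrite scale1r mul1r !add0r.
  split=> [a _ _ _ _ [[v1 r1] G1 [t _ [<- <-]]] [[v2 r2] G2 [u _ [<- <-]]]|].
    exists (a *: v1 + v2, a * r1 + r2); first exact: Glin.
    exists (a * t + u) => //=; congr (_, _); last by ring.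
    by rewrite scalerDl scalerDr -scalerA addrACA.
  by move=> _ _ [[w s] Gw [t _ [<- <-]]]; exact: rP.
pose phi v : R^o := projT1 (cid (Gtot v)).
have Gphi v : G (v, phi v) by exact: projT2 (cid (Gtot v)).
have phi_lin : linear phi.
  move=> a u v; apply: (dominated_graph_fun _ _ _ _ Gd (Gphi _)).
  exact: Glin.
pose philin : {linear V -> R^o} :=
  HB.pack phi (GRing.isLinear.Build R V R^o _ phi phi_lin).
by exists philin => v; exact: Gp.
Qed.

End dominated_extension.

(** * The dual norm *)

(** Continuity makes the supremum that defines the dual norm the supremum of a
    bounded set, so that it is an upper bound. *)
Lemma ler_dual_norm (R : realType) (X : normedModType R)
    (phi : {linear X -> R^o}) (x : X) :
  dual X phi -> `|phi x| <= dual_norm phi * `|x|.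
Proof.
move=> phi_cont.
have [->|x0] := eqVneq x 0; first by rewrite linear0 !normr0 mulr0.
have nx0 : 0 < `|x| by rewrite normr_gt0.
have /linear_boundedP bdd := (linear_bounded_continuous phi).2 phi_cont.
have [r [r0 phi_le]] : exists r, 0 < r /\ forall y, `|phi y| <= r * `|y|.
  near (pinfty_nbhs R) => r; exists r; split.
    by near: r; exact: nbhs_pinfty_gt.
  by near: r; exact: bdd.
rewrite -ler_pdivrMr //.
have -> : `|phi x| / `|x| = `|phi (`|x|^-1 *: x)|.
  by rewrite linearZ/= normrM normfV normr_id mulrC.
apply: ub_le_sup; last first.
  exists (`|x|^-1 *: x) => //=.
  by rewrite normrZ normfV normr_id mulVf ?gt_eqF.
exists r => _ [y /= y1 <-]; apply: (le_trans (phi_le y)).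
by rewrite -[leRHS]mulr1 ler_pM2l.
Unshelve. all: by end_near. Qed.

(** A one-sided bound is enough, because it can be applied to [- x]. *)
Lemma dual_norm_le (R : realType) (X : normedModType R)
    (phi : {linear X -> R^o}) (l : R) :
  0 <= l -> (forall x, phi x <= l * `|x|) -> dual X phi /\ dual_norm phi <= l.
Proof.
move=> l0 phi_le.
have abs_le x : `|phi x| <= l * `|x|.
  rewrite ler_norml phi_le andbT lerNl.
  by have := phi_le (- x); rewrite linearN normrN.
split.
  apply: bounded_linear_continuous; apply/linear_boundedP; near=> r.
  have lr : l <= r by near: r; apply: nbhs_pinfty_ge; exact: num_real.
  by move=> x; apply: (le_trans (abs_le x)); exact: ler_wpM2r.
apply: ge_sup.
  by exists `|phi 0|; exists 0 => //=; rewrite normr0.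
move=> _ [x /= x1 <-]; apply: (le_trans (abs_le x)).
by rewrite -[leRHS]mulr1 ler_wpM2l.
Unshelve. all: by end_near. Qed.

(** * Lipschitz continuity and subgradients *)

(** The absolute value can be dropped by exchanging [x] and [y]. *)
Lemma lipschitzP (R : realType) (X : normedModType R) (f : X -> R^o) (l : R) :
  l.-lipschitz f <-> forall x y, f y - f x <= l * `|y - x|.
Proof.
split=> [lip x y|lip [x y] _ /=].
  exact: le_trans (ler_norm _) (lip (y, x) (conj I I)).
by rewrite ler_norml lip andbT lerNl opprB distrC.
Qed.

(** A linear functional dominated by [h |-> f (x + h) - f x] is a subgradient at
    [x]; the Lipschitz bound on this function gives continuity and the norm. *)
Lemma lipschitz_subgradient (R : realType) (X : normedModType R)
    (f : X -> R^o) (l : R) (x : X) :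
  convex_function [set: convex_lmodType X] f -> 0 <= l -> l.-lipschitz f ->
  exists2 phi, subdifferential f x phi & dual_norm phi <= l.
Proof.
move=> cvx l0 /lipschitzP lip.
pose p h : R^o := f (x + h) - f x.
have cvxp : convex_function [set: convex_lmodType X] p.
  apply/convex_functionP => a b h k a0 b0 ab1.
  have := (convex_functionP _ _ f).1 cvx a b (x + h) (x + k) a0 b0 ab1.
  rewrite !scalerDr addrACA -scalerDl ab1 scale1r /p.
  have -> : a = 1 - b by lra.
  lra.
have p0 : 0 <= p 0 by rewrite /p addr0 subrr.
have [phi phi_le] := hahn_banach_convex _ _ _ cvxp p0.
have [||phi_dual phi_norm] := dual_norm_le _ _ phi l => // [h|].
  apply: (le_trans (phi_le h)).
  by have := lip x (x + h); rewrite [x + h - x]addrC addKr.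
exists phi => //; split=> // y.
by apply: (le_trans (phi_le _)); rewrite /p subrKC.
Qed.

(** With [z = x + t *: (y - x)] far from the origin and [phi] a subgradient at
    [z], one has [t * (f y - f x) <= f z - f x <= t * phi (y - x)] by convexity
    and by the subgradient inequality between [z] and [x]. *)
Lemma subgradient_far_lipschitz (R : realType) (X : normedModType R)
    (f : X -> R^o) (l M : R) :
  convex_function [set: convex_lmodType X] f ->
  (forall x, M < `|x| ->
    exists2 phi, subdifferential f x phi & dual_norm phi <= l) ->
  l.-lipschitz f.
Proof.
move=> cvx far; apply/lipschitzP => x y.
have [->|yx] := eqVneq y x; first by rewrite !subrr normr0 mulr0.
set h := y - x.
have h0 : 0 < `|h| by rewrite normr_gt0 subr_eq0.
(* [t >= 1], and [t * `|h|] exceeds [`|M| + `|x|] by [`|h|], so that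
   [`|x + t *: h| > M] *)
pose t := 1 + (`|M| + `|x|) / `|h|.
have t1 : 1 <= t by rewrite lerDl divr_ge0 // addr_ge0.
have t0 : 0 < t by lra.
have [|phi [phi_dual phi_sub] phi_norm] := far (x + t *: h).
  have := lerB_normD (t *: h) x; rewrite [_ *: _ + _]addrC; apply: lt_le_trans.
  rewrite normrZ gtr0_norm // /t mulrDl mul1r divfK ?gt_eqF //.
  have := ler_norm M; lra.
have := convex_slope_le _ _ f x h t cvx t1.
rewrite {1}/h subrKC => slope.
rewrite -(ler_pM2l t0); apply: (le_trans slope).
have := phi_sub x; rewrite opprD addNKr linearN/= linearZ/= => sub.
have le1 : f (x + t *: h) - f x <= t * phi h.
  by move: sub; rewrite /GRing.scale/=; lra.
apply: (le_trans le1); rewrite ler_pM2l //.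
apply: (le_trans (ler_norm _)).
apply: (le_trans (ler_dual_norm _ _ _ _ phi_dual)).
exact: ler_wpM2r.
Qed.

(** The infimum [dist0 A] need not be attained, whence the strict inequality in
    the hypothesis. *)
Lemma dist0_lt (R : realType) (X : normedModType R)
    (A : set {linear X -> R^o}) (r : R) :
  (dist0 A < r%:E)%E -> exists2 phi, A phi & dual_norm phi <= r.
Proof.
move=> /ereal_inf_lt[_ [phi Aphi <-]]; rewrite lte_fin => /ltW.
by exists phi.
Qed.

Theorem corollary4p2 (R : realType) (X : completeNormedModType R)
    (f : X -> R^o) (l : R) :
  lsc f -> convex_fun f -> 0 <= l ->
  l.-lipschitz f <->
  (limf_esup (fun x => dist0 (subdifferential f x)) (norm_pinfty_nbhs X)
     <= l%:E)%E.
Proof.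
move=> _ /convex_fun_convex_function cvx l0; split=> [lip|limsup_le].
  (* any member of the filter will do: the bound holds at every point *)
  apply: ge_ereal_inf; exists (ereal_sup
    [set dist0 (subdifferential f x) | x in [set x : X | 0 < `|x|]]).
    by exists [set x : X | 0 < `|x|] => //; exists 0.
  apply: ge_ereal_sup => _ [x _ <-]; apply: ge_ereal_inf.
  have [phi phi_sub phi_norm] := lipschitz_subgradient _ _ f l x cvx l0 lip.
  by exists (dual_norm phi)%:E; [exists phi|rewrite lee_fin].
apply/lipschitzP => x y; apply/ler_addgt0Pr => e e0.
(* the summand 1 keeps the denominator positive when [x = y] *)
pose d := e / (1 + `|y - x|).
have n1 : 0 < 1 + `|y - x| by rewrite ltr_pwDl.
have d0 : 0 < d by exact: divr_gt0.
have /ereal_inf_lt[_ [V [M _ MV] <-] supV] :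
    (limf_esup (fun x => dist0 (subdifferential f x)) (norm_pinfty_nbhs X)
      < (l + d)%:E)%E.
  by apply: (le_lt_trans limsup_le); rewrite lte_fin ltrDl.
have lip : (l + d).-lipschitz f.
  apply: (subgradient_far_lipschitz _ _ _ _ M cvx) => z Mz; apply: dist0_lt.
  apply: le_lt_trans supV; apply: ereal_sup_ubound; exists z => //.
  exact: MV.
apply: (le_trans ((lipschitzP _ _ _ _).1 lip x y)).
rewrite mulrDl lerD2l /d mulrAC ler_pdivrMr // ler_pM2l //.
by rewrite lerDr.
Qed.
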